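(* Consider the following equations (where $a\leqslant b$ abbreviates $a\wedge b=a$): (E1) $e\leqslant (x\to y)\vee(y\to x)$; (E2) $e\leqslant (x\to(y\vee\neg y))\vee(y\wedge\neg y)$; (E3) $e\leqslant (f^2\to x)\vee(x\to e)\vee\neg x$; (E4) $x\wedge(x\to f)\leqslant (f\to x)\vee(x\to e)$; (E5) $x\to e\leqslant x\vee(f^2\to\neg x)$. Then, relative to the variety of De Morgan monoids: (i) $\mathbb{V}(\mathbf{2})$ is axiomatized by adding $x\leqslant e$ to the axioms of De Morgan monoids; (ii) $\mathbb{V}(\mathbf{S}_3)$ is axiomatized by adding $e=f$, (E1) and (E2); (iii) $\mathbb{V}(\mathbf{D}_4)$ is axiomatized by adding $x\leqslant f^2$, $x\wedge\neg x\leqslant y$ and (E3); (iv) $\mathbb{V}(\mathbf{C}_4)$ is axiomatized by adding $x\leqslant f^2$, $e\leqslant f$, (E1), (E4) and (E5).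
   Context: An involutive (commutative) residuated lattice (IRL) is an algebra $\langle A;\cdot,\wedge,\vee,\neg,e\rangle$ such that $\langle A;\cdot,e\rangle$ is a commutative monoid, $\langle A;\wedge,\vee\rangle$ is a lattice with order $\leqslant$, $\neg\neg x=x$, and $x\cdot y\leqslant z\iff \neg z\cdot y\leqslant\neg x$. Write $f:=\neg e$, $x\to y:=\neg(x\cdot\neg y)$, $f^2:=f\cdot f$. A De Morgan monoid is an IRL with distributive lattice reduct satisfying $x\leqslant x\cdot x$. $\mathbb{V}(\mathbf{X})$ is the variety generated by $\mathbf{X}$. $\mathbf{2}$: the two-element Boolean algebra on $\{f<e\}$ with $\cdot=\wedge$. $\mathbf{S}_3$: the chain $\bot<e=f<\top$, $\neg$ swaps $\bot,\top$ and fixes $e$, $e$ neutral, $\bot\cdot x=\bot$ for all $x$, $\top\cdot\top=\top$. $\mathbf{C}_4$: the chain $0<e<f<1$, $\neg$ swaps $0,1$ and $e,f$, $e$ neutral, $0\cdot x=0$, $1\cdot x=1$ for $x\neq0$, $f\cdot f=1$. $\mathbf{D}_4$: the lattice with bottom $0$, top $1$, $e,f$ incomparable, $\neg$ swaps $0,1$ and $e,f$, $e$ neutral, $0\cdot x=0$, $1\cdot x=1$ for $x\neq 0$, $f\cdot f=1$. *)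

(* Defs.v *)
From mathcomp Require Export ssreflect ssrfun ssrbool.

Set Implicit Arguments.
Unset Strict Implicit.
Unset Printing Implicit Defensive.

(* Algebras of the signature <A; ., /\, \/, ~, e>, with no axioms imposed. *)
Record algebra : Type := Algebra {
  carrier :> Type;
  mul : carrier -> carrier -> carrier;
  meet : carrier -> carrier -> carrier;
  join : carrier -> carrier -> carrier;
  neg : carrier -> carrier;
  one : carrier }.

Arguments mul {a} _ _.
Arguments meet {a} _ _.
Arguments join {a} _ _.
Arguments neg {a} _.
Arguments one {a}.

Declare Scope alg_scope.
Delimit Scope alg_scope with alg.
Notation "∼ x" := (neg x) (at level 35, right associativity) : alg_scope.
Notation "x ⊙ y" := (mul x y) (at level 40, left associativity) : alg_scope.
Notation "x ⊓ y" := (meet x y) (at level 50, left associativity) : alg_scope.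
Notation "x ⊔ y" := (join x y) (at level 50, left associativity) : alg_scope.
Notation "x ≼ y" := (meet x y = x) (at level 70, no associativity) : alg_scope.
Local Open Scope alg_scope.

Definition imp {A : algebra} (x y : A) : A := ∼ (x ⊙ ∼ y).
Notation "x ⊸ y" := (imp x y) (at level 55, right associativity) : alg_scope.

(* The derived constants f = ~ e and f^2 = f . f. *)
Definition ff {A : algebra} : A := ∼ one.
Definition ff2 {A : algebra} : A := ff ⊙ ff.

Record involutive_residuated_lattice (A : algebra) : Prop := {
  irl_mulA : associative (@mul A);
  irl_mulC : commutative (@mul A);
  irl_mul1 : left_id one (@mul A);
  irl_meetA : associative (@meet A);
  irl_meetC : commutative (@meet A);
  irl_joinA : associative (@join A);
  irl_joinC : commutative (@join A);
  irl_meet_join : forall x y : A, x ⊓ (x ⊔ y) = x;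
  irl_join_meet : forall x y : A, x ⊔ (x ⊓ y) = x;
  irl_negK : involutive (@neg A);
  irl_res : forall x y z : A, x ⊙ y ≼ z <-> ∼ z ⊙ y ≼ ∼ x }.

Record de_morgan_monoid (A : algebra) : Prop := {
  dmm_irl : involutive_residuated_lattice A;
  dmm_distr : forall x y z : A, x ⊓ (y ⊔ z) = (x ⊓ y) ⊔ (x ⊓ z);
  dmm_sqi : forall x : A, x ≼ x ⊙ x }.

Record homomorphism (A B : algebra) (h : A -> B) : Prop := {
  hom_mul : {morph h : x y / x ⊙ y};
  hom_meet : {morph h : x y / x ⊓ y};
  hom_join : {morph h : x y / x ⊔ y};
  hom_neg : {morph h : x / ∼ x};
  hom_one : h one = one }.

Definition product (I : Type) (F : I -> algebra) : algebra :=
  @Algebra (forall i, F i)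
    (fun x y i => x i ⊙ y i)
    (fun x y i => x i ⊓ y i)
    (fun x y i => x i ⊔ y i)
    (fun x i => ∼ x i)
    (fun _ => one).

(* Closure under homomorphic images, subalgebras and direct products.  An
   injective homomorphism B -> A presents B as a subalgebra of A up to
   isomorphism, and a variety is in any case closed under isomorphism. *)
Record variety (K : algebra -> Prop) : Prop := {
  variety_H : forall (A B : algebra) (h : A -> B),
    homomorphism h -> (forall b, exists a, h a = b) -> K A -> K B;
  variety_S : forall (A B : algebra) (h : B -> A),
    homomorphism h -> injective h -> K A -> K B;
  variety_P : forall (I : Type) (F : I -> algebra),
    (forall i, K (F i)) -> K (product F) }.

(* The least variety containing X. *)
Definition generated_variety (X : algebra) (A : algebra) : Prop :=
  forall K : algebra -> Prop, variety K -> K X -> K A.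

(* [axioms A] states that A satisfies the additional equations. *)
Definition axiomatized_over_dmm (V axioms : algebra -> Prop) : Prop :=
  forall A : algebra, V A <-> de_morgan_monoid A /\ axioms A.

Definition alg_2 : algebra := Algebra andb andb orb negb true.

Inductive S3_carrier : Set := S3_bot | S3_e | S3_top.

Definition S3_mul (x y : S3_carrier) : S3_carrier :=
  match x, y with
  | S3_bot, _ | _, S3_bot => S3_bot
  | S3_e, z | z, S3_e => z
  | S3_top, S3_top => S3_top
  end.

Definition S3_meet (x y : S3_carrier) : S3_carrier :=
  match x, y with
  | S3_bot, _ | _, S3_bot => S3_bot
  | S3_top, z | z, S3_top => z
  | S3_e, S3_e => S3_e
  end.

Definition S3_join (x y : S3_carrier) : S3_carrier :=
  match x, y with
  | S3_top, _ | _, S3_top => S3_top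
  | S3_bot, z | z, S3_bot => z
  | S3_e, S3_e => S3_e
  end.

Definition S3_neg (x : S3_carrier) : S3_carrier :=
  match x with
  | S3_bot => S3_top
  | S3_e => S3_e
  | S3_top => S3_bot
  end.

Definition alg_S3 : algebra := Algebra S3_mul S3_meet S3_join S3_neg S3_e.

(* C_4 and D_4 have the same carrier, multiplication and negation, and differ
   only in their lattice order. *)
Inductive four : Set := Four_0 | Four_e | Four_f | Four_1.

Definition four_mul (x y : four) : four :=
  match x, y with
  | Four_0, _ | _, Four_0 => Four_0
  | Four_e, z | z, Four_e => z
  | Four_1, _ | _, Four_1 => Four_1
  | Four_f, Four_f => Four_1
  end.

Definition four_neg (x : four) : four :=
  match x with
  | Four_0 => Four_1
  | Four_e => Four_f
  | Four_f => Four_e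
  | Four_1 => Four_0
  end.

Definition C4_meet (x y : four) : four :=
  match x, y with
  | Four_0, _ | _, Four_0 => Four_0
  | Four_e, _ | _, Four_e => Four_e
  | Four_f, _ | _, Four_f => Four_f
  | Four_1, Four_1 => Four_1
  end.

Definition C4_join (x y : four) : four :=
  match x, y with
  | Four_1, _ | _, Four_1 => Four_1
  | Four_f, _ | _, Four_f => Four_f
  | Four_e, _ | _, Four_e => Four_e
  | Four_0, Four_0 => Four_0
  end.

Definition alg_C4 : algebra := Algebra four_mul C4_meet C4_join four_neg Four_e.

Definition D4_meet (x y : four) : four :=
  match x, y with
  | Four_1, z | z, Four_1 => z
  | Four_e, Four_e => Four_e
  | Four_f, Four_f => Four_f
  | _, _ => Four_0
  end.

Definition D4_join (x y : four) : four :=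
  match x, y with
  | Four_0, z | z, Four_0 => z
  | Four_e, Four_e => Four_e
  | Four_f, Four_f => Four_f
  | _, _ => Four_1
  end.

Definition alg_D4 : algebra := Algebra four_mul D4_meet D4_join four_neg Four_e.

Definition E1 (A : algebra) : Prop :=
  forall x y : A, one ≼ (x ⊸ y) ⊔ (y ⊸ x).
Definition E2 (A : algebra) : Prop :=
  forall x y : A, one ≼ (x ⊸ (y ⊔ ∼ y)) ⊔ (y ⊓ ∼ y).
Definition E3 (A : algebra) : Prop :=
  forall x : A, one ≼ (ff2 ⊸ x) ⊔ (x ⊸ one) ⊔ ∼ x.
Definition E4 (A : algebra) : Prop :=
  forall x : A, x ⊓ (x ⊸ ff) ≼ (ff ⊸ x) ⊔ (x ⊸ one).
Definition E5 (A : algebra) : Prop :=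
  forall x : A, x ⊸ one ≼ x ⊔ (ff2 ⊸ ∼ x).

(* Main.v *)
(** In the quotient of a De Morgan monoid by a prime lattice filter containing
[one], the unit is join-prime, so there each of the added equations is a case distinction
on the order, and they leave no elements beyond those of an image of the generating
algebra [X].  By Zorn's lemma every De Morgan monoid is a subdirect product of
such quotients, which puts it in the variety generated by [X]. *)

From mathcomp Require Import boolp classical_sets.
Require Import Defs.
Local Open Scope alg_scope.

Set Implicit Arguments.
Unset Strict Implicit.
Unset Printing Implicit Defensive.

(** * De Morgan monoids *)

Section DeMorganMonoid.
Context (A : algebra) (dA : de_morgan_monoid A).
Implicit Types x y z u v : A.

Let iA := dmm_irl dA.
Let mulA := irl_mulA iA.
Let mulC := irl_mulC iA.
Let mul1 := irl_mul1 iA.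
Let negK := irl_negK iA.
Let meetA := irl_meetA iA.
Let meetC := irl_meetC iA.
Let joinC := irl_joinC iA.

Lemma meetxx x : x ⊓ x = x.
Proof. by rewrite -{2}(irl_join_meet iA x x) (irl_meet_join iA). Qed.

Lemma le_trans y x z : x ≼ y -> y ≼ z -> x ≼ z.
Proof. by move=> xy yz; rewrite -xy -meetA yz. Qed.

Lemma le_anti x y : x ≼ y -> y ≼ x -> x = y.
Proof. by move=> xy yx; rewrite -xy meetC. Qed.

Lemma leIl x y : x ⊓ y ≼ x.
Proof. by rewrite (meetC x) -meetA meetxx. Qed.

Lemma leIr x y : x ⊓ y ≼ y.
Proof. by rewrite -meetA meetxx. Qed.

Lemma lexI x y z : x ≼ y -> x ≼ z -> x ≼ y ⊓ z.
Proof. by move=> xy xz; rewrite meetA xy. Qed.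

Lemma leUl x y : x ≼ x ⊔ y.
Proof. exact: irl_meet_join. Qed.

Lemma leUr x y : y ≼ x ⊔ y.
Proof. by rewrite joinC; apply: leUl. Qed.

Lemma join_r x y : x ≼ y -> x ⊔ y = y.
Proof. by move=> <-; rewrite joinC (meetC x) (irl_join_meet iA). Qed.

Lemma join_l x y : x ≼ y -> y ⊔ x = y.
Proof. by move=> xy; rewrite joinC join_r. Qed.

Lemma joinxx x : x ⊔ x = x.
Proof. exact/join_r/meetxx. Qed.

Lemma meet_r x y : x ≼ y -> y ⊓ x = x.
Proof. by move=> xy; rewrite meetC. Qed.

Lemma leUx x y z : x ≼ z -> y ≼ z -> x ⊔ y ≼ z.
Proof. by move=> xz yz; rewrite meetC (dmm_distr dA) (meet_r xz) (meet_r yz). Qed.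

Lemma leN x y : x ≼ y -> ∼ y ≼ ∼ x.
Proof.
move=> xy; have /(irl_res iA) : x ⊙ one ≼ y by rewrite mulC mul1.
by rewrite mulC mul1.
Qed.

Lemma leNl x y : ∼ x ≼ y -> ∼ y ≼ x.
Proof. by move/leN; rewrite negK. Qed.

Lemma leNr x y : x ≼ ∼ y -> y ≼ ∼ x.
Proof. by move/leN; rewrite negK. Qed.

Lemma negU x y : ∼ (x ⊔ y) = ∼ x ⊓ ∼ y.
Proof.
apply: le_anti; first by apply: lexI; apply: leN; [exact: leUl | exact: leUr].
by apply: leNr; apply: leUx; apply: leNr; [exact: leIl | exact: leIr].
Qed.

(** Residuation turns the goal into [∼ (y ⊙ z) ⊙ z ≼ ∼ x]. The same law applied to [y ⊙ z ≼ y ⊙ z]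
    bounds the left side by [∼ y], which lies below [∼ x]. *)
Lemma leM2r z x y : x ≼ y -> x ⊙ z ≼ y ⊙ z.
Proof.
move=> xy; apply: (proj2 (irl_res iA _ _ _)); apply: le_trans (leN xy).
exact: (proj1 (irl_res iA y z (y ⊙ z))) (meetxx _).
Qed.

Lemma leM2l z x y : x ≼ y -> z ⊙ x ≼ z ⊙ y.
Proof. by rewrite ![z ⊙ _]mulC; apply: leM2r. Qed.

Lemma le_imp x y z : x ≼ y ⊸ z <-> x ⊙ y ≼ z.
Proof.
rewrite (irl_res iA) /imp (mulC y).
by split=> /leN; rewrite !negK.
Qed.

Lemma one_le_imp x y : one ≼ x ⊸ y <-> x ≼ y.
Proof. by rewrite le_imp mul1. Qed.

(** Square the meet, which only increases it, then enlarge each factor. *)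
Lemma leIM x y : x ⊓ y ≼ x ⊙ y.
Proof.
apply: le_trans (dmm_sqi dA _) _.
exact: le_trans (leM2r _ (leIl _ _)) (leM2l _ (leIr _ _)).
Qed.

(** After negation the goal is [∼ x ⊓ x ≼ ff]. The meet lies below the product, and [∼ x ⊙ x ≼ ff]
    is residuation applied to [one ⊙ x ≼ x]. *)
Lemma excluded_middle x : one ≼ x ⊔ ∼ x.
Proof.
rewrite -[one]negK; apply: leNl; rewrite negU negK.
apply: le_trans (leIM _ _) _.
by apply: (proj1 (irl_res iA one x x)); rewrite mul1 meetxx.
Qed.

Lemma negf : ∼ @ff A = one. Proof. exact: negK. Qed.

(** Residuation reduces [z ⊙ x ≼ z] to [z ≼ x ⊸ z], an instance of minimality. *)
Lemma mul_bottom z : (forall x, z ≼ x) -> forall x, z ⊙ x = z.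
Proof. by move=> z_min x; apply: le_anti => //; apply/le_imp/z_min. Qed.

(** * Prime deductive filters *)

Record prime_filter (F : A -> Prop) : Prop := {
  filter_one : F one;
  filter_up : forall x y, x ≼ y -> F x -> F y;
  filter_meet : forall x y, F x -> F y -> F (x ⊓ y);
  filter_prime : forall x y, F (x ⊔ y) -> F x \/ F y }.

(** A filter M maximal among those missing c is prime: if x and y are both outside M, then
    [m ⊓ x ≼ c] and [n ⊓ y ≼ c] for some m and n in M, and distributivity gives
    [(m ⊓ n) ⊓ (x ⊔ y) ≼ c], so [x ⊔ y] is outside M too. *)
Lemma prime_filter_avoiding c :
  ~ one ≼ c -> exists2 F, prime_filter F & ~ F c.
Proof.
move=> one_c.
(* The empty set is let in, so that the union of the empty chain qualifies. *)
pose P (X : A -> Prop) := [/\ forall x, X x -> X one,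
  forall x y, x ≼ y -> X x -> X y,
  forall x y, X x -> X y -> X (x ⊓ y) & ~ X c].
have [|M [[M1 Mup MI Mc] Mmax]] := @Zorn_bigcup A P.
  move=> C CP tot; split.
  - move=> x [X CX Xx]; exists X => //.
    by have [X1 _ _ _] := CP X CX; apply: X1 Xx.
  - move=> x y xy [X CX Xx]; exists X => //.
    by have [_ Xup _ _] := CP X CX; apply: Xup Xx.
  - move=> x y [X CX Xx] [Y CY Yy].
    have [XY|YX] := tot X Y CX CY.
      by exists Y => //; have [_ _ YI _] := CP Y CY; apply: YI => //; apply: XY.
    by exists X => //; have [_ _ XI _] := CP X CX; apply: XI => //; apply: YX.
  - by move=> [X CX Xc]; have [_ _ _] := CP X CX; apply.
(* Without [one], M would be empty, hence properly contained in the up-set of [one], which misses c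
   by hypothesis. *)
have Mone : M one.
  apply: contrapT => Mone; apply: (Mmax (fun x => one ≼ x)).
    split=> [x /M1 //|]; move/(_ one (meetxx _)); exact: Mone.
  split=> [x _|x y xy x1|x y|//]; first exact: meetxx.
    exact: le_trans xy.
  exact: lexI.
(* Otherwise the filter generated by M and x would miss c and properly extend M. *)
have maximal x : ~ M x -> exists2 m, M m & m ⊓ x ≼ c.
  move=> Mx; apply: contrapT => noM.
  apply: (Mmax (fun y => exists2 m, M m & m ⊓ x ≼ y)).
    split=> [y My|sub]; first by exists y => //; apply: leIl.
    by apply: Mx; apply: sub; exists one => //; apply: leIr.
  split=> [y _|y z yz [m Mm my]|y z [m Mm my] [n Mn nz]|//].
  - by exists one => //; apply: leIl.
  - by exists m => //; apply: le_trans yz.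
  - exists (m ⊓ n); first exact: MI.
    apply: lexI; [apply: le_trans my | apply: le_trans nz];
      apply: lexI (leIr _ _); apply: le_trans (leIl _ _) _;
      [exact: leIl | exact: leIr].
exists M => //; split=> // x y Mxy; apply: contrapT => /not_orP[Mx My].
have [[m Mm mx] [n Mn ny]] := (maximal x Mx, maximal y My).
apply: Mc; apply: (Mup ((m ⊓ n) ⊓ (x ⊔ y))); last by apply: (MI) => //; apply: MI.
rewrite (dmm_distr dA); apply: leUx.
  apply: le_trans mx; apply: lexI (leIr _ _).
  exact: le_trans (leIl _ _) (leIl _ _).
apply: le_trans ny; apply: lexI (leIr _ _).
exact: le_trans (leIl _ _) (leIr _ _).
Qed.

(* Multiplication by a lower bound of [one] in [F], unlike implication, is
   compatible with the lattice operations. *)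
Definition filter_cong (F : A -> Prop) x y : Prop :=
  exists u, [/\ F u, u ≼ one, u ⊙ x ≼ y & u ⊙ y ≼ x].

End DeMorganMonoid.

(** * Congruences and quotient algebras *)

Record congruence (A : algebra) (R : A -> A -> Prop) : Prop := {
  cong_refl : forall x, R x x;
  cong_sym : forall x y, R x y -> R y x;
  cong_trans : forall x y z, R x y -> R y z -> R x z;
  cong_mul : forall x y z t, R x y -> R z t -> R (x ⊙ z) (y ⊙ t);
  cong_meet : forall x y z t, R x y -> R z t -> R (x ⊓ z) (y ⊓ t);
  cong_join : forall x y z t, R x y -> R z t -> R (x ⊔ z) (y ⊔ t);
  cong_neg : forall x y, R x y -> R (∼ x) (∼ y) }.

(** Transitivity multiplies the witnesses: [u ⊙ v] is in F because it lies above [u ⊓ v].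
    Compatibility with joins follows from that with meets and negation by De Morgan's law. *)
Lemma filter_congP (A : algebra) (F : A -> Prop) :
  de_morgan_monoid A -> prime_filter F -> congruence (filter_cong F).
Proof.
move=> dA pF; have iA := dmm_irl dA.
have trans x y z : filter_cong F x y -> filter_cong F y z -> filter_cong F x z.
  move=> [u [Fu u1 uxy uyx]] [v [Fv v1 vyz vzy]]; exists (u ⊙ v); split.
  - by apply: (filter_up pF) (leIM dA u v) _; apply: (filter_meet pF).
  - apply: (le_trans dA) (leM2r dA v u1) _.
    by rewrite (irl_mul1 iA).
  - rewrite (irl_mulC iA u) -(irl_mulA iA).
    exact: (le_trans dA) (leM2l dA v uxy) vyz.
  - rewrite -(irl_mulA iA).
    exact: (le_trans dA) (leM2l dA u vzy) uyx.
have sym x y : filter_cong F x y -> filter_cong F y x.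
  by move=> [u [? ? ? ?]]; exists u.
have mulr z x y : filter_cong F x y -> filter_cong F (x ⊙ z) (y ⊙ z).
  move=> [u [Fu u1 uxy uyx]]; exists u.
  by split=> //; rewrite (irl_mulA iA); apply: leM2r.
have meetr z x y : filter_cong F x y -> filter_cong F (x ⊓ z) (y ⊓ z).
  move=> [u [Fu u1 uxy uyx]]; exists u.
  (* This is where the bound [u ≼ one] enters. *)
  have uz : u ⊙ z ≼ z by rewrite -{2}[z](irl_mul1 iA); apply: leM2r.
  have le a b : u ⊙ a ≼ b -> u ⊙ (a ⊓ z) ≼ b ⊓ z.
    move=> ab; apply: (lexI dA).
      exact: (le_trans dA) (leM2l dA u (leIl dA _ _)) ab.
    exact: (le_trans dA) (leM2l dA u (leIr dA _ _)) uz.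
  by split=> //; apply: le.
have neg x y : filter_cong F x y -> filter_cong F (∼ x) (∼ y).
  move=> [u [Fu u1 uxy uyx]]; exists u; split=> //; rewrite (irl_mulC iA);
  by apply/(irl_res iA); rewrite !(irl_negK iA) (irl_mulC iA).
have meet2 x y z t :
    filter_cong F x y -> filter_cong F z t -> filter_cong F (x ⊓ z) (y ⊓ t).
  move=> xy zt; apply: trans (meetr z _ _ xy) _.
  by rewrite ![y ⊓ _](irl_meetC iA); apply: meetr.
split=> // [x|x y z t xy zt|x y z t xy zt].
- by exists one; split; rewrite ?(irl_mul1 iA) ?(meetxx dA) //; apply: filter_one.
- apply: trans (mulr z _ _ xy) _.
  by rewrite ![y ⊙ _](irl_mulC iA); apply: mulr.
- rewrite -[x ⊔ z](irl_negK iA) -[y ⊔ t](irl_negK iA) !(negU dA).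
  by apply/neg/meet2; apply: neg.
Qed.

(** The carrier is a system of representatives, namely the fixed points of a choice function [rep]
    that is constant on classes; operations are computed in A and then sent back to
    representatives. *)
Lemma quotient (A : algebra) (R : A -> A -> Prop) :
  congruence R -> exists (Q : algebra) (q : A -> Q),
    [/\ homomorphism q, forall b, exists a, q a = b
      & forall x y, q x = q y <-> R x y].
Proof.
move=> cR.
pose rep x := sval (cid (ex_intro (R x) x (cong_refl cR x))).
have repR x : R x (rep x) by rewrite /rep; case: cid.
have repE x y : R x y -> rep x = rep y.
  (* Related elements have the same class as a predicate, and the choice depends on that predicate
     alone, existence proofs being irrelevant. *)
  move=> xy; rewrite /rep; suff e : R x = R y.
    move: (ex_intro _ _ _) (ex_intro _ _ _); rewrite e => Rx Ry.
    congr (sval (cid _)); exact: Prop_irrelevance.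
  apply/predeqP => z; split; last exact: (cong_trans cR) _ _ _ xy.
  exact: (cong_trans cR) _ _ _ (cong_sym cR xy).
pose T := {x | rep x = x}.
pose q x : T := exist _ (rep x) (esym (repE _ _ (repR x))).
have qE x y : R x y -> q x = q y by move=> xy; apply: eq_exist; exact: (repE).
pose Q := @Algebra T (fun x y => q (sval x ⊙ sval y))
  (fun x y => q (sval x ⊓ sval y)) (fun x y => q (sval x ⊔ sval y))
  (fun x => q (∼ sval x)) (q one).
exists Q, q; split.
- split=> // [x y|x y|x y|x]; apply: qE => /=.
  + exact: (cong_mul cR) _ _ _ _ (repR x) (repR y).
  + exact: (cong_meet cR) _ _ _ _ (repR x) (repR y).
  + exact: (cong_join cR) _ _ _ _ (repR x) (repR y).
  + exact: (cong_neg cR) _ _ (repR x).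
- by move=> [x ex]; exists x; apply: eq_exist.
- move=> x y; split=> [[exy]|]; last exact: qE.
  apply: (cong_trans cR) _ _ _ (repR x) _; rewrite exy.
  exact: (cong_sym cR) (repR y).
Qed.

(** * Varieties *)

Lemma hom_imp (A B : algebra) (h : A -> B) :
  homomorphism h -> forall x y, h (x ⊸ y) = h x ⊸ h y.
Proof. by move=> hh x y; rewrite /imp !(hom_neg hh, hom_mul hh). Qed.

Lemma hom_ff (A B : algebra) (h : A -> B) : homomorphism h -> h ff = ff.
Proof. by move=> hh; rewrite /ff (hom_neg hh) (hom_one hh). Qed.

Lemma hom_ff2 (A B : algebra) (h : A -> B) : homomorphism h -> h ff2 = ff2.
Proof. by move=> hh; rewrite /ff2 (hom_mul hh) (hom_ff hh). Qed.

Lemma proj_hom (I : Type) (F : I -> algebra) (i : I) :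
  homomorphism (fun x : product F => x i).
Proof. by []. Qed.

(** Stands in for a term in two variables: commuting with homomorphisms is what preservation of an
    identity under images, subalgebras and products relies on. *)
Definition natural (l : forall A : algebra, A -> A -> A) : Prop :=
  forall (A B : algebra) (h : A -> B), homomorphism h ->
  forall x y, h (l A x y) = l B (h x) (h y).

Lemma variety_law (l r : forall A : algebra, A -> A -> A) :
  natural l -> natural r -> variety (fun A => forall x y : A, l A x y = r A x y).
Proof.
move=> nl nr; split=> [A B h hh hs e x y|A B h hh hi e x y|I F e x y].
- have [[a <-] [b <-]] := (hs x, hs y).
  by rewrite -(nl _ _ _ hh) -(nr _ _ _ hh) e.
- by apply: hi; rewrite (nl _ _ _ hh) (nr _ _ _ hh) e.
- apply: functional_extensionality_dep => i.
  have ph := @proj_hom I F i.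
  by rewrite (nl _ _ _ ph) (nr _ _ _ ph) e.
Qed.

Lemma variety_le (l r : forall A : algebra, A -> A -> A) :
  natural l -> natural r -> variety (fun A => forall x y : A, l A x y ≼ r A x y).
Proof.
move=> nl nr; apply: (variety_law (l := fun A x y => l A x y ⊓ r A x y)) (nl).
by move=> A B h hh x y; rewrite (hom_meet hh) (nl _ _ _ hh) (nr _ _ _ hh).
Qed.

Lemma variety_ext (K L : algebra -> Prop) :
  (forall A, K A <-> L A) -> variety K -> variety L.
Proof. by move=> KL; have -> : L = K by apply/predeqP => A; rewrite KL. Qed.

Lemma variety_and (K L : algebra -> Prop) :
  variety K -> variety L -> variety (fun A => K A /\ L A).
Proof.
move=> vK vL; split=> [A B h hh hs [KA LA]|A B h hh hi [KA LA]|I F KL].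
- by split; [exact: (variety_H vK hh hs KA) | exact: (variety_H vL hh hs LA)].
- by split; [exact: (variety_S vK hh hi KA) | exact: (variety_S vL hh hi LA)].
- by split; [apply: (variety_P vK) | apply: (variety_P vL)] => i; case: (KL i).
Qed.

(* Residuation is a quasi-identity: to lift an instance [x ⊙ y ≼ z] along a
   surjective homomorphism, replace a preimage [c] of [z] by [c ⊔ a ⊙ b]. *)
Lemma hom_image_dmm (A B : algebra) (h : A -> B) :
  homomorphism h -> (forall b, exists a, h a = b) ->
  de_morgan_monoid A -> de_morgan_monoid B.
Proof.
move=> hh hs dA; have iA := dmm_irl dA.
have hE := (hom_mul hh, hom_meet hh, hom_join hh, hom_neg hh, hom_one hh).
have joinB (x y : B) : y ⊔ (x ⊓ y) = y.
  have [[a <-] [b <-]] := (hs x, hs y).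
  by rewrite -!hE (irl_meetC iA) (irl_join_meet iA).
have resB (x y z : B) : x ⊙ y ≼ z -> ∼ z ⊙ y ≼ ∼ x.
  have [[a <-] [[b <-] [c <-]]] := (hs x, (hs y, hs z)) => abc.
  have -> : h c = h (c ⊔ a ⊙ b) by rewrite hE hE -abc joinB.
  rewrite -!hE; congr h.
  exact/(proj1 (irl_res iA _ _ _))/leUr.
split; first split.
- move=> x y z; have [[a <-] [[b <-] [c <-]]] := (hs x, (hs y, hs z)).
  by rewrite -!hE (irl_mulA iA).
- move=> x y; have [[a <-] [b <-]] := (hs x, hs y).
  by rewrite -!hE (irl_mulC iA).
- by move=> x; have [a <-] := hs x; rewrite -!hE (irl_mul1 iA).
- move=> x y z; have [[a <-] [[b <-] [c <-]]] := (hs x, (hs y, hs z)).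
  by rewrite -!hE (irl_meetA iA).
- move=> x y; have [[a <-] [b <-]] := (hs x, hs y).
  by rewrite -!hE (irl_meetC iA).
- move=> x y z; have [[a <-] [[b <-] [c <-]]] := (hs x, (hs y, hs z)).
  by rewrite -!hE (irl_joinA iA).
- move=> x y; have [[a <-] [b <-]] := (hs x, hs y).
  by rewrite -!hE (irl_joinC iA).
- move=> x y; have [[a <-] [b <-]] := (hs x, hs y).
  by rewrite -!hE (irl_meet_join iA).
- move=> x y; have [[a <-] [b <-]] := (hs x, hs y).
  by rewrite -!hE (irl_join_meet iA).
- by move=> x; have [a <-] := hs x; rewrite -!hE (irl_negK iA).
- move=> x y z; split; first exact: resB.
  have negB (t : B) : ∼ ∼ t = t by have [a <-] := hs t; rewrite -!hE (irl_negK iA).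
  by move/resB; rewrite !negB.
- move=> x y z; have [[a <-] [[b <-] [c <-]]] := (hs x, (hs y, hs z)).
  by rewrite -!hE (dmm_distr dA).
- by move=> x; have [a <-] := hs x; rewrite -!hE (dmm_sqi dA).
Qed.

Lemma subalgebra_dmm (A B : algebra) (h : B -> A) :
  homomorphism h -> injective h -> de_morgan_monoid A -> de_morgan_monoid B.
Proof.
move=> hh hi dA; have iA := dmm_irl dA.
have hE := (hom_mul hh, hom_meet hh, hom_join hh, hom_neg hh, hom_one hh).
(* The order is defined by an equation, so an injective homomorphism reflects it; residuation can
   then be pulled back. *)
have hle x y : x ≼ y <-> h x ≼ h y by rewrite -hE; split=> [->|/hi].
split; first split.
- by move=> x y z; apply: hi; rewrite !hE (irl_mulA iA).
- by move=> x y; apply: hi; rewrite !hE (irl_mulC iA).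
- by move=> x; apply: hi; rewrite !hE (irl_mul1 iA).
- by move=> x y z; apply: hi; rewrite !hE (irl_meetA iA).
- by move=> x y; apply: hi; rewrite !hE (irl_meetC iA).
- by move=> x y z; apply: hi; rewrite !hE (irl_joinA iA).
- by move=> x y; apply: hi; rewrite !hE (irl_joinC iA).
- by move=> x y; apply: hi; rewrite !hE (irl_meet_join iA).
- by move=> x y; apply: hi; rewrite !hE (irl_join_meet iA).
- by move=> x; apply: hi; rewrite !hE (irl_negK iA).
- by move=> x y z; rewrite !hle !hE; apply: irl_res.
- by move=> x y z; apply: hi; rewrite !hE (dmm_distr dA).
- by move=> x; apply: hi; rewrite !hE (dmm_sqi dA).
Qed.

Lemma product_dmm (I : Type) (F : I -> algebra) :
  (forall i, de_morgan_monoid (F i)) -> de_morgan_monoid (product F).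
Proof.
move=> dF; have iF i := dmm_irl (dF i).
have leP (x y : product F) : x ≼ y <-> forall i, x i ≼ y i.
  split=> [xy i|xy]; first by rewrite -{2}xy.
  exact: functional_extensionality_dep.
split; first split.
- by move=> x y z; apply: functional_extensionality_dep => i; apply: irl_mulA.
- by move=> x y; apply: functional_extensionality_dep => i; apply: irl_mulC.
- by move=> x; apply: functional_extensionality_dep => i; apply: irl_mul1.
- by move=> x y z; apply: functional_extensionality_dep => i; apply: irl_meetA.
- by move=> x y; apply: functional_extensionality_dep => i; apply: irl_meetC.
- by move=> x y z; apply: functional_extensionality_dep => i; apply: irl_joinA.
- by move=> x y; apply: functional_extensionality_dep => i; apply: irl_joinC.
- by move=> x y; apply: functional_extensionality_dep => i; apply: irl_meet_join.
- by move=> x y; apply: functional_extensionality_dep => i; apply: irl_join_meet.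
- by move=> x; apply: functional_extensionality_dep => i; apply: irl_negK.
- move=> x y z; rewrite !leP; split=> xyz i.
    exact: (proj1 (irl_res (iF i) _ _ _) (xyz i)).
  exact: (proj2 (irl_res (iF i) _ _ _) (xyz i)).
- by move=> x y z; apply: functional_extensionality_dep => i; apply: dmm_distr.
- by move=> x; apply/leP => i; apply: dmm_sqi.
Qed.

Lemma variety_dmm : variety de_morgan_monoid.
Proof. split; [exact: hom_image_dmm|exact: subalgebra_dmm|exact: product_dmm]. Qed.

(** One separating homomorphism is chosen for each pair of distinct elements; together they embed A
    in the product of their targets. *)
Lemma variety_subdirect (K : algebra -> Prop) (A : algebra) :
  variety K ->
  (forall a b : A, a <> b -> exists (Q : algebra) (h : A -> Q),
     [/\ homomorphism h, K Q & h a <> h b]) ->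
  K A.
Proof.
move=> vK sep; pose I := {p : A * A | p.1 <> p.2}.
have sepI (i : I) : exists (Q : algebra) (h : A -> Q),
    [/\ homomorphism h, K Q & h (sval i).1 <> h (sval i).2].
  by case: i => p ne; apply: sep.
pose Q i := sval (cid (sepI i)).
have hQ i : exists h : A -> Q i,
    [/\ homomorphism h, K (Q i) & h (sval i).1 <> h (sval i).2].
  by rewrite /Q; case: cid.
pose h i := sval (cid (hQ i)).
have hP i : [/\ homomorphism (h i), K (Q i) & h i (sval i).1 <> h i (sval i).2].
  by rewrite /h; case: cid.
have KP : K (product Q) by apply: (variety_P vK) => i; case: (hP i).
apply: (variety_S vK) (fun a => (fun i => h i a) : product Q) _ _ KP.
  by split=> [x y|x y|x y|x|]; apply: functional_extensionality_dep => i;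
    case: (hP i) => hh _ _; case: hh.
move=> a b hab; apply: contrapT => ne.
have [_ _] := hP (exist _ (a, b) ne); apply.
exact: (congr1 (fun f : product Q => f (exist _ (a, b) ne)) hab).
Qed.

(** * Algebras in which the unit is join-prime *)

(** For De Morgan monoids this amounts to finite subdirect irreducibility, the trivial algebra
    included. *)
Definition join_prime_one (A : algebra) : Prop :=
  forall x y : A, one ≼ x ⊔ y -> one ≼ x \/ one ≼ y.

(** If a is not below b, some prime filter F misses [a ⊸ b]. In the quotient by F the elements above
    [one] are exactly the images of members of F, so primeness of F makes [one] join-prime. The
    images of a and b differ, since [u ⊙ a ≼ b] with u in F would put [a ⊸ b] in F. *)
Lemma variety_join_prime (K : algebra -> Prop) (A : algebra) :
  variety K -> de_morgan_monoid A ->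
  (forall (Q : algebra) (q : A -> Q), homomorphism q ->
     (forall b, exists a, q a = b) -> join_prime_one Q -> K Q) ->
  K A.
Proof.
move=> vK dA KQ; have iA := dmm_irl dA.
have sep (a b : A) : ~ a ≼ b -> exists (Q : algebra) (h : A -> Q),
    [/\ homomorphism h, K Q & h a <> h b].
  move=> ab; have [|F pF Fab] := @prime_filter_avoiding A dA (a ⊸ b).
    by rewrite (one_le_imp dA).
  have [Q [q [hq qs qE]]] := quotient (filter_congP dA pF).
  have qF x : one ≼ q x <-> F x.
    rewrite -(hom_one hq) -(hom_meet hq) qE; split.
      move=> [u [Fu u1 _ ux]]; apply: (filter_up pF) _ _ _ Fu.
      rewrite (irl_mulC iA) (irl_mul1 iA) in ux.
      exact: (le_trans dA) ux (leIr dA _ _).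
    move=> Fx; exists (one ⊓ x); split.
    - by apply: (filter_meet pF) => //; apply: (filter_one pF).
    - exact: leIl.
    - apply: (le_trans dA) (leM2r dA _ (leIl dA _ _)) _.
      by rewrite (irl_mul1 iA); apply: leIl.
    - by rewrite (irl_mulC iA) (irl_mul1 iA) (meetxx dA).
  exists Q, q; split=> //.
    apply: (KQ Q q) => // x y.
    have [[c <-] [d <-]] := (qs x, qs y).
    by rewrite -(hom_join hq) !qF; apply: filter_prime.
  move/qE => [u [Fu _ uab _]]; apply: Fab; apply: (filter_up pF) _ _ _ Fu.
  exact/(le_imp dA).
apply: (variety_subdirect vK) _ => a b ne.
have [ab|/sep //] := EM (a ≼ b).
have [ba|/sep [Q [h [hh KQ' hne]]]] := EM (b ≼ a).
  by case: ne; apply: (le_anti dA).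
by exists Q, h; split=> // /esym.
Qed.

(** The De Morgan monoids satisfying the axioms form a variety containing X, which gives one
    inclusion. For the other, the join-prime quotients of A are images of X, hence lie in every
    variety containing X. The surjection may collapse elements, so the trivial algebra is
    covered. *)
Lemma axiomatized_by (X : algebra) (axioms : algebra -> Prop) :
  de_morgan_monoid X -> variety axioms -> axioms X ->
  (forall Q : algebra, de_morgan_monoid Q -> axioms Q -> join_prime_one Q ->
     exists2 h : X -> Q, homomorphism h & forall b, exists a, h a = b) ->
  axiomatized_over_dmm (generated_variety X) axioms.
Proof.
move=> dX va aX quo A; split=> [gA|[dA aA] K vK KX].
  exact: (gA (fun B => de_morgan_monoid B /\ axioms B)
             (variety_and variety_dmm va) (conj dX aX)).
apply: (variety_join_prime vK dA) _ => Q q hq qs jp.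
have [||//|h hh hs] := quo Q.
- exact: (hom_image_dmm hq qs dA).
- exact: (variety_H va hq qs aA).
- exact: (variety_H vK hh hs KX).
Qed.

(** * The four axiomatizations *)

Lemma dmm_2 : de_morgan_monoid alg_2.
Proof. by split; first split; repeat case. Qed.

Lemma dmm_S3 : de_morgan_monoid alg_S3.
Proof. by split; first split; repeat case. Qed.

Lemma dmm_D4 : de_morgan_monoid alg_D4.
Proof. by split; first split; repeat case. Qed.

Lemma dmm_C4 : de_morgan_monoid alg_C4.
Proof. by split; first split; repeat case. Qed.

(** * The added equations define varieties *)

Ltac prove_natural :=
  intros A B h hh x y;
  match goal with hh : homomorphism _ |- _ =>
    by rewrite ?(hom_join hh, hom_meet hh, hom_mul hh, hom_imp hh, hom_neg hh,
                 hom_ff2 hh, hom_ff hh, hom_one hh)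
  end.

(** The second variable is a dummy that makes the law fit the two-variable format of [variety_le];
    the lemmas below use the same device. *)
Lemma variety_le_one : variety (fun A : algebra => forall x : A, x ≼ one).
Proof.
apply: variety_ext (variety_le (l := fun A x _ => x) (r := fun A _ _ => one) _ _);
  try prove_natural.
by move=> A; split=> [e x|e x _]; [exact: (e x x)|exact: e].
Qed.

Lemma variety_one_ff : variety (fun A : algebra => @one A = ff).
Proof.
apply: variety_ext (variety_law (l := fun A _ _ => one) (r := fun A _ _ => ff) _ _);
  try prove_natural.
by move=> A; split=> [e|e _ _]; [exact: (e one one)|exact: e].
Qed.

Lemma variety_one_le_ff : variety (fun A : algebra => @one A ≼ ff).
Proof.
apply: variety_ext (variety_le (l := fun A _ _ => one) (r := fun A _ _ => ff) _ _);
  try prove_natural.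
by move=> A; split=> [e|e _ _]; [exact: (e one one)|exact: e].
Qed.

Lemma variety_le_ff2 : variety (fun A : algebra => forall x : A, x ≼ ff2).
Proof.
apply: variety_ext (variety_le (l := fun A x _ => x) (r := fun A _ _ => ff2) _ _);
  try prove_natural.
by move=> A; split=> [e x|e x _]; [exact: (e x x)|exact: e].
Qed.

Lemma variety_contradiction :
  variety (fun A : algebra => forall x y : A, x ⊓ ∼ x ≼ y).
Proof.
by apply: (variety_le (l := fun A x _ => x ⊓ ∼ x) (r := fun A _ y => y));
  prove_natural.
Qed.

Lemma variety_E1 : variety E1.
Proof.
by apply: (variety_le (l := fun A _ _ => one)
                      (r := fun A x y => (x ⊸ y) ⊔ (y ⊸ x))); prove_natural.
Qed.

Lemma variety_E2 : variety E2.
Proof.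
by apply: (variety_le (l := fun A _ _ => one)
  (r := fun A x y => (x ⊸ (y ⊔ ∼ y)) ⊔ (y ⊓ ∼ y))); prove_natural.
Qed.

Lemma variety_E3 : variety E3.
Proof.
apply: variety_ext (variety_le (l := fun A _ _ => one)
  (r := fun A x _ => (ff2 ⊸ x) ⊔ (x ⊸ one) ⊔ ∼ x) _ _); try prove_natural.
by move=> A; split=> [e x|e x _]; [exact: (e x x)|exact: e].
Qed.

Lemma variety_E4 : variety E4.
Proof.
apply: variety_ext (variety_le (l := fun A x _ => x ⊓ (x ⊸ ff))
  (r := fun A x _ => (ff ⊸ x) ⊔ (x ⊸ one)) _ _); try prove_natural.
by move=> A; split=> [e x|e x _]; [exact: (e x x)|exact: e].
Qed.

Lemma variety_E5 : variety E5.
Proof.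
apply: variety_ext (variety_le (l := fun A x _ => x ⊸ one)
  (r := fun A x _ => x ⊔ (ff2 ⊸ ∼ x)) _ _); try prove_natural.
by move=> A; split=> [e x|e x _]; [exact: (e x x)|exact: e].
Qed.

(** * Join-prime models as images of the generators *)

Lemma E1_total (A : algebra) :
  de_morgan_monoid A -> join_prime_one A -> E1 A ->
  forall x y : A, x ≼ y \/ y ≼ x.
Proof.
by move=> dA jp e1 x y; case: (jp _ _ (e1 x y)) => /(one_le_imp dA); [left|right].
Qed.

(** Negating [x ≼ one] makes [ff] the bottom. Join-primeness applied to excluded middle puts x or
    [∼ x] above [one], so x is [one] or [ff]. *)
Lemma quotient_2 (A : algebra) :
  de_morgan_monoid A -> (forall x : A, x ≼ one) -> join_prime_one A ->
  exists2 h : alg_2 -> A, homomorphism h & forall b, exists a, h a = b.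
Proof.
move=> dA x1 jp; have iA := dmm_irl dA.
have fx (x : A) : ff ≼ x by apply: (leNl dA).
have ffM := mul_bottom dA fx.
exists (fun b => if b then one else ff).
  by split=> [[] []|[] []|[] []|[]|] //=;
    rewrite ?(irl_mul1 iA) ?(joinxx dA) ?(join_r dA (fx _)) ?(join_l dA (fx _))
            ?(negf dA)
            ?(meet_r dA (fx _)).
move=> x; have [x_ge|nx_ge] := jp _ _ (excluded_middle dA x).
  by exists true; apply: (le_anti dA).
exists false; apply: (le_anti dA) => //; rewrite /= /ff; exact: (leNr dA).
Qed.

Lemma quotient_S3 (A : algebra) :
  de_morgan_monoid A -> [/\ @one A = ff, E1 A & E2 A] -> join_prime_one A ->
  exists2 h : alg_S3 -> A, homomorphism h & forall b, exists a, h a = b.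
Proof.
move=> dA [ef e1 e2] jp; have iA := dmm_irl dA.
have total := E1_total dA jp e1.
have N1 : ∼ @one A = one by rewrite {2}ef.
(* E2 splits: either x lies below [y ⊔ ∼ y], or both y and [∼ y] lie above [one], which is its own
   negation, and then y is [one]. *)
have top_or_one (y : A) : (forall x, x ≼ y ⊔ ∼ y) \/ y = one.
  have [->|ne] := EM (y = one); [by right|left=> x].
  have [/(one_le_imp dA) //|y1] := jp _ _ (e2 x y).
  case: ne; apply: (le_anti dA); last exact: (le_trans dA) y1 (leIl dA _ _).
  rewrite -N1; apply: (leNr dA); exact: (le_trans dA) y1 (leIr dA _ _).
(* The trivial algebra has no element other than [one] from which to build a top. *)
have [triv|] := EM (forall y : A, y = one).
  exists (fun _ => one); last by move=> b; exists S3_e.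
  by split=> *; rewrite ?[RHS]triv.
move=> /existsNP [y ne]; have [top|//] := top_or_one y.
pose t := y ⊔ ∼ y; rewrite -/t in top.
have bot (x : A) : ∼ t ≼ x by apply: (leNl dA).
have botM := mul_bottom dA bot.
have ttK : t ⊙ t = t by apply: (le_anti dA) => //; apply: (dmm_sqi dA).
exists (fun x => match x with S3_bot => ∼ t | S3_e => one | S3_top => t end).
  split=> [[] []|[] []|[] []|[]|] //=; rewrite ?botM ?ttK ?(irl_negK iA) //;
  rewrite ?(irl_mulC iA t) ?botM ?(irl_mul1 iA) ?(meetxx dA) ?(joinxx dA)
    ?(meet_r dA (bot _)) ?(meet_r dA (top _))
    ?(join_r dA (bot _)) ?(join_l dA (bot _)) ?(join_r dA (top _))
    ?(join_l dA (top _)) //.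
have topE (z : A) : (forall x, x ≼ z) -> z = t by move=> zt; apply: (le_anti dA).
move=> b; have [bt| ->] := top_or_one b; last by exists S3_e.
(* The larger of b and [∼ b] equals [b ⊔ ∼ b], hence is the top. *)
have [bN|Nb] := total b (∼ b).
  exists S3_bot; rewrite /= -(topE (∼ b)) ?(irl_negK iA) // => x.
  by rewrite -(join_r dA bN).
exists S3_top; rewrite /= (topE b) // => x.
by rewrite -(join_l dA Nb).
Qed.

(** Every element of [alg_C4] and [alg_D4] is the value of a constant term, so this is the only
    candidate for a homomorphism from either. *)
Definition four_map (A : algebra) (x : four) : A :=
  match x with
  | Four_0 => ∼ ff2 | Four_e => one | Four_f => ff | Four_1 => ff2
  end.

Lemma four_map_mul (A : algebra) :
  de_morgan_monoid A -> (forall x : A, x ≼ ff2) ->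
  {morph @four_map A : x y / four_mul x y >-> x ⊙ y}.
Proof.
move=> dA top; have iA := dmm_irl dA.
have bot (x : A) : ∼ ff2 ≼ x by apply: (leNl dA).
have botM := mul_bottom dA bot.
(* Multiplying [ff ≼ ff2] by [ff] gives the nontrivial inequality. *)
have ff2f : ff2 ⊙ ff = ff2 :> A.
  by apply: (le_anti dA) => //; apply: (leM2r dA).
have ff2K : ff2 ⊙ ff2 = ff2 :> A.
  by apply: (le_anti dA) => //; apply: dmm_sqi.
by case=> [] [] /=; rewrite ?botM // ?(irl_mul1 iA) // (irl_mulC iA)
  ?botM ?(irl_mul1 iA).
Qed.

Lemma four_map_neg (A : algebra) :
  de_morgan_monoid A -> {morph @four_map A : x / four_neg x >-> ∼ x}.
Proof. by move=> dA [] /=; rewrite ?(irl_negK (dmm_irl dA)) ?(negf dA). Qed.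

Lemma quotient_D4 (A : algebra) :
  de_morgan_monoid A ->
  [/\ forall x : A, x ≼ ff2, forall x y : A, x ⊓ ∼ x ≼ y & E3 A] ->
  join_prime_one A ->
  exists2 h : alg_D4 -> A, homomorphism h & forall b, exists a, h a = b.
Proof.
move=> dA [top contra e3] jp; have iA := dmm_irl dA.
have bot (x : A) : ∼ ff2 ≼ x by apply: (leNl dA).
have efI : one ⊓ ff = ∼ ff2 :> A by apply: (le_anti dA) => //; apply: contra.
have efU : one ⊔ ff = ff2 :> A.
  apply: (le_anti dA) => //; rewrite -[_ ⊔ _](irl_negK iA); apply: (leNr dA).
  by rewrite (negU dA); apply: contra.
(* Comparability of [one] and [ff] collapses A: if [one ≼ ff], then [one] is the bottom [one ⊓ ff],
   which absorbs products. The converse comparison reduces to this one. *)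
have triv : @one A ≼ ff -> forall x : A, x = one.
  move=> ef x; rewrite -[x](irl_mul1 iA).
  by apply: (mul_bottom dA) => z; rewrite -ef efI.
have ef_fe : @ff A ≼ one -> @one A ≼ ff.
  move=> fe; rewrite (join_l dA fe) in efU; rewrite efU.
  by have := leM2r dA ff fe; rewrite (irl_mul1 iA).
have hom : @homomorphism alg_D4 A (@four_map A).
  split=> [|[] []|[] []||] //=; first exact: four_map_mul; last exact: four_map_neg;
  by rewrite ?(irl_meetC iA ff one) ?(irl_joinC iA ff one) ?efI ?efU
    ?(meetxx dA) ?(joinxx dA) ?(meet_r dA (bot _)) ?(meet_r dA (top _))
    ?(join_r dA (bot _)) ?(join_l dA (bot _)) ?(join_r dA (top _))
    ?(join_l dA (top _)).
exists (@four_map A) => //.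
have cls (x : A) : [\/ x = ff2, x ≼ one | x ≼ ff].
  have [/jp[]|/(leNr dA) xf] := jp _ _ (e3 x); last by apply: Or33.
    by move=> /(one_le_imp dA) tx; apply: Or31; apply: (le_anti dA).
  by move=> /(one_le_imp dA); apply: Or32.
(* Both x and [∼ x] are classified; combinations that make [one] and [ff] comparable fall to
   [triv]. *)
move=> x; have [->|xe|xf] := cls x; first by exists Four_1.
  have [nx|/(leNl dA) fx|/(leN dA)] := cls (∼ x).
  - by exists Four_0; rewrite /= -nx (irl_negK iA).
  - by exists Four_e; rewrite (triv _ x) //; apply/ef_fe/(le_trans dA fx).
  - rewrite (irl_negK iA) (negf dA) => ex.
    by exists Four_e; apply: (le_anti dA).
have [nx|/(leNl dA) fx|/(leN dA)] := cls (∼ x).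
- by exists Four_0; rewrite /= -nx (irl_negK iA).
- by exists Four_f; apply: (le_anti dA).
- rewrite (irl_negK iA) (negf dA) => ex.
  by exists Four_e; rewrite (triv _ x) //; apply: (le_trans dA ex).
Qed.

(** E1 makes A a chain. E5 leaves only [one] and the bottom below [one], E4 leaves only the
    endpoints between [one] and [ff], and negation carries the part above [ff] to the part below
    [one]. *)
Lemma quotient_C4 (A : algebra) :
  de_morgan_monoid A ->
  [/\ forall x : A, x ≼ ff2, @one A ≼ ff, E1 A, E4 A & E5 A] ->
  join_prime_one A ->
  exists2 h : alg_C4 -> A, homomorphism h & forall b, exists a, h a = b.
Proof.
move=> dA [top ef e1 e4 e5] jp; have iA := dmm_irl dA.
have total := E1_total dA jp e1.
have bot (x : A) : ∼ ff2 ≼ x by apply: (leNl dA).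
have hom : @homomorphism alg_C4 A (@four_map A).
  split=> [|[] []|[] []||] //=; first exact: four_map_mul; last exact: four_map_neg;
  by rewrite ?ef ?(meet_r dA ef) ?(join_r dA ef) ?(join_l dA ef)
    ?(meetxx dA) ?(joinxx dA) ?(meet_r dA (bot _)) ?(meet_r dA (top _))
    ?(join_r dA (bot _)) ?(join_l dA (bot _)) ?(join_r dA (top _))
    ?(join_l dA (top _)).
exists (@four_map A) => //.
have low (x : A) : x ≼ one -> x = one \/ x = ∼ ff2.
  move=> x1; have x1' : one ≼ x ⊸ one by apply/(one_le_imp dA).
  have [ex|/(one_le_imp dA) tx] := jp _ _ (le_trans dA x1' (e5 x)).
    by left; apply: (le_anti dA).
  by right; apply: (le_anti dA) => //; apply: (leNr dA).
have middle (x : A) : one ≼ x -> x ≼ ff -> x = one \/ x = ff.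
  move=> ex xf; have h : one ≼ x ⊓ (x ⊸ ff).
    by apply: (lexI dA) => //; apply/(one_le_imp dA).
  have [/(one_le_imp dA) fx|/(one_le_imp dA) xe] := jp _ _ (le_trans dA h (e4 x)).
    by right; apply: (le_anti dA).
  by left; apply: (le_anti dA).
move=> x; have [/low[]->|ex] := total x one; [by exists Four_e|by exists Four_0|].
have [/(middle _ ex)[]->|/(leN dA)] := total x ff;
  [by exists Four_e|by exists Four_f|].
rewrite (negf dA) => /low[] nx.
  by exists Four_f; rewrite /= /ff -nx (irl_negK iA).
by exists Four_1; rewrite /= -[ff2](irl_negK iA) -nx (irl_negK iA).
Qed.

Theorem theorem6p2 :
  [/\ axiomatized_over_dmm (generated_variety alg_2)
        (fun A => forall x : A, x ≼ one),
      axiomatized_over_dmm (generated_variety alg_S3)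
        (fun A => [/\ @one A = ff, E1 A & E2 A]),
      axiomatized_over_dmm (generated_variety alg_D4)
        (fun A => [/\ forall x : A, x ≼ ff2,
                      forall x y : A, x ⊓ ∼ x ≼ y
                    & E3 A])
    & axiomatized_over_dmm (generated_variety alg_C4)
        (fun A => [/\ forall x : A, x ≼ ff2, @one A ≼ ff, E1 A, E4 A & E5 A])].
Proof.
split; apply: axiomatized_by.
- exact: dmm_2.
- exact: variety_le_one.
- by case.
- exact: quotient_2.
- exact: dmm_S3.
- apply: variety_ext (variety_and variety_one_ff (variety_and variety_E1 variety_E2)).
  by move=> A; split=> [[? []]|[]].
- by split=> //; repeat case.
- exact: quotient_S3.
- exact: dmm_D4.
- apply: variety_ext (variety_and variety_le_ff2
    (variety_and variety_contradiction variety_E3)).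
  by move=> A; split=> [[? []]|[]].
- by split; repeat case.
- exact: quotient_D4.
- exact: dmm_C4.
- apply: variety_ext (variety_and variety_le_ff2 (variety_and variety_one_le_ff
    (variety_and variety_E1 (variety_and variety_E4 variety_E5)))).
  by move=> A; split=> [[? [? [? []]]]|[]].
- by split=> //; repeat case.
- exact: quotient_C4.
Qed.
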